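(* Let $m\ge 1$ be an integer. The number of maximum nonattacking arrangements of pawns on a $2m\times 2m$ chessboard is $\binom{2m}{m}^2$.
   Context: A $p\times q$ chessboard is the grid of cells $(r,c)$ with $1\le r\le p$ (rows, numbered from top to bottom) and $1\le c\le q$ (columns, numbered from left to right). An arrangement of pawns is a set of cells, namely those occupied by a pawn (at most one pawn per cell, pawns indistinguishable). All pawns face the same vertical direction, and a pawn attacks the (at most two) cells diagonally adjacent to it in the neighbouring row it faces. An arrangement is nonattacking (independent) if no pawn attacks a cell occupied by another pawn; equivalently, no two occupied cells $(r,c),(r',c')$ satisfy $|r-r'|=|c-c'|=1$. A maximum nonattacking arrangement is a nonattacking arrangement with the largest possible number of pawns among all nonattacking arrangements on the given board. Arrangements are counted as subsets of cells; arrangements differing by a symmetry of the board are counted as different. *)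

(* Defs.v *)
From mathcomp Require Import all_boot.

Set Implicit Arguments.
Unset Strict Implicit.
Unset Printing Implicit Defensive.

(* Rows and columns are numbered from 0, row 0 being the top one. *)
Definition cell (p q : nat) : finType := ('I_p * 'I_q)%type.

(* Pawns face upwards, i.e. towards smaller row numbers; by nonattackingP below
   the common direction does not matter for nonattacking arrangements. *)
Definition attacks p q (x y : cell p q) : bool :=
  (y.1.+1 == x.1 :> nat) &&
  ((y.2.+1 == x.2 :> nat) || (y.2 == x.2.+1 :> nat)).

Definition nonattacking p q (A : {set cell p q}) : bool :=
  [forall x in A, forall y in A, ~~ attacks x y].

Definition max_nonattacking p q (A : {set cell p q}) : bool :=
  nonattacking A &&
  [forall B : {set cell p q}, nonattacking B ==> (#|B| <= #|A|)].

(* On nat, (a - b) + (b - a) is the absolute difference of a and b. *)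
Lemma nonattackingP p q (A : {set cell p q}) :
  reflect (forall x y, x \in A -> y \in A ->
             ~ ((x.1 - y.1) + (y.1 - x.1) = 1 /\
                (x.2 - y.2) + (y.2 - x.2) = 1))
          (nonattacking A).
Proof.
have distP (a b : nat) : (a - b) + (b - a) = 1 <-> a = b.+1 \/ b = a.+1.
  split=> [|[]->]; last 2 first.
  - by rewrite subSnn (eqP (leqnSn b)) addn0.
  - by rewrite subSnn (eqP (leqnSn a)).
  case: (leqP a b) => [le_ab | /ltnW le_ba].
    by rewrite (eqP le_ab) add0n => d; right; rewrite -(subnK le_ab) d.
  by rewrite (eqP le_ba) addn0 => d; left; rewrite -(subnK le_ba) d.
apply: (iffP forall_inP) => [nA x y xA yA [] | nA x xA].
  case/distP=> e1 /distP e2.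
    have /forall_inP/(_ y yA)/negP[] := nA x xA.
    by rewrite /attacks e1 eqxx; case: e2 => ->; rewrite eqxx ?orbT.
  have /forall_inP/(_ x xA)/negP[] := nA y yA.
  by rewrite /attacks e1 eqxx; case: e2 => ->; rewrite eqxx ?orbT.
apply/forall_inP => y yA; apply/negP => /andP[/eqP e1 e2].
apply: (nA x y xA yA); split; apply/distP; first by left.
by case/orP: e2 => /eqP; [left | right].
Qed.

(* Main.v *)
Require Import Defs.
From mathcomp Require Import all_boot zify.

(** Cut the board into 2 x 2 blocks.  The two cells on a diagonal of a block
    attack each other, so a nonattacking arrangement holds at most one of them;
    as the 4 m^2 cells are paired off in this way ([partner]), it has at most
    2 m^2 pawns.  This bound is reached, hence the maximum arrangements are the
    nonattacking ones that hold exactly one cell of each pair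
    ([max_nonattackingP]).

    Such an arrangement is described by two m x m tables of bits, one for the
    main diagonals of the blocks and one for their antidiagonals: the bit of a
    diagonal says whether its pawn is on the lower row.  Attacks preserve the
    colour of a cell, thus the two tables do not interact, and inside one table
    the nonattacking condition says that a pawn on the lower row forces the
    pawns of the block below and of the block next to it (on the right for main
    diagonals, on the left for antidiagonals) to be on the lower row as well.
    After reversing the columns of the table of main diagonals, both tables are
    monotone: along each row of a table the 1s form an initial segment, whose
    length is nondecreasing from top to bottom.  A table is therefore a
    nondecreasing sequence of m numbers in 0..m, of which there are C(2m, m),
    and the two tables are chosen independently. *)

Set Implicit Arguments.
Unset Strict Implicit.
Unset Printing Implicit Defensive.

(** One attack only relates neighbouring blocks, hence the hypothesis about
    consecutive indices; it propagates by induction on the distance, and a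
    down-closed set is the initial segment of its cardinality. *)
Lemma initial_segmentE m (P : pred 'I_m) :
  (forall k l : 'I_m, l = k.+1 :> nat -> P l -> P k) ->
  forall k : 'I_m, P k = (k < #|P|).
Proof.
move=> Pdown.
have Ple (d : nat) (k l : 'I_m) : l = k + d :> nat -> P l -> P k.
  elim: d k => [|d IHd] k lE Pl.
    by rewrite -(_ : l = k) //; apply: val_inj; rewrite /= lE addn0.
  have ltk1 : k.+1 < m by have := ltn_ord l; lia.
  by apply: (Pdown k (Ordinal ltk1)) => //; apply: IHd => //=; lia.
have card_below n : n <= m -> #|[pred j : 'I_m | j < n]| = n.
  by move=> le_nm; rewrite -sum1_card (big_ord_narrow le_nm) sum1_card card_ord.
move=> k; have [Pk | nPk] := boolP (P k); apply/esym.
  rewrite -(card_below _ (ltn_ord k)); apply/subset_leq_card/subsetP => j.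
  by rewrite inE => le_jk; apply: (Ple (k - j) j k) => //; lia.
apply/negbTE; rewrite -leqNgt -(card_below _ (ltnW (ltn_ord k))).
apply/subset_leq_card/subsetP => j Pj; rewrite inE ltnNge.
by apply: contra nPk => le_kj; apply: (Ple (j - k) k j) => //; lia.
Qed.

Lemma eq_threshold m a b :
  a <= m -> b <= m -> (forall k : 'I_m, (k < a) = (k < b)) -> a = b.
Proof.
have one_side a' b' : b' <= m -> (forall k : 'I_m, (k < a') = (k < b')) -> b' <= a'.
  move=> le_bm eq_ab; rewrite leqNgt; apply/negP => lt_ab.
  by have := eq_ab (Ordinal (leq_trans lt_ab le_bm)); rewrite /= ltnn lt_ab.
by move=> le_am le_bm eq_ab; apply/anti_leq/andP; split; apply: one_side.
Qed.

(** * Coordinates adapted to the 2 x 2 blocks *)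

Section Board.

Variable m : nat.
Local Notation board := (cell (2 * m) (2 * m)).
Implicit Types (A : {set board}) (x y : board) (i j k l : 'I_m) (b e : bool).

Fact half_ord_subproof (r : 'I_(2 * m)) : r./2 < m.
Proof. by have := ltn_ord r; lia. Qed.

Definition half_ord r := Ordinal (half_ord_subproof r).

Fact double_ord_subproof b i : b + i.*2 < 2 * m.
Proof. by have := ltn_ord i; lia. Qed.

Definition double_ord b i := Ordinal (double_ord_subproof b i).

Lemma odd_double_ord b i : odd (double_ord b i) = b.
Proof. by rewrite /= oddD odd_double addbF; case: b. Qed.

Lemma half_double_ord b i : half_ord (double_ord b i) = i.
Proof. by apply: val_inj; rewrite /= half_bit_double. Qed.

Lemma double_half_ord (r : 'I_(2 * m)) : double_ord (odd r) (half_ord r) = r.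
Proof. by apply: val_inj; rewrite /= odd_double_half. Qed.

Definition on_main_diag x : bool := odd x.1 == odd x.2.

Definition rev_if e i := if e then rev_ord i else i.

Lemma rev_ifK e : involutive (rev_if e).
Proof. by case: e => // i; apply: rev_ordK. Qed.

Definition table_row x : 'I_m := half_ord x.1.

(** The block column, reversed on main diagonals: this makes the two tables
    monotone in the same direction. *)
Definition table_col x : 'I_m := rev_if (on_main_diag x) (half_ord x.2).

(** The flag [e] selects the table of main diagonals, [b] the lower cell of the
    diagonal.  The lower cell is in the right (odd) column exactly on a main
    diagonal, and the upper one exactly on an antidiagonal, whence the column
    parity [b == e]. *)
Definition cell_at b e i k : board :=
  (double_ord b i, double_ord (b == e) (rev_if e k)).

Lemma odd_row_cell_at b e i k : odd (cell_at b e i k).1 = b.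
Proof. exact: odd_double_ord. Qed.

Lemma on_main_diag_cell_at b e i k : on_main_diag (cell_at b e i k) = e.
Proof. by rewrite /on_main_diag !odd_double_ord; case: b; case: e. Qed.

Lemma table_row_cell_at b e i k : table_row (cell_at b e i k) = i.
Proof. exact: half_double_ord. Qed.

Lemma table_col_cell_at b e i k : table_col (cell_at b e i k) = k.
Proof. by rewrite /table_col on_main_diag_cell_at half_double_ord rev_ifK. Qed.

Definition cell_atE := (odd_row_cell_at, on_main_diag_cell_at,
  table_row_cell_at, table_col_cell_at).

Lemma cell_at_coords x :
  cell_at (odd x.1) (on_main_diag x) (table_row x) (table_col x) = x.
Proof.
rewrite /cell_at rev_ifK (_ : _ == on_main_diag x = odd x.2).
  by rewrite !double_half_ord -surjective_pairing.
by rewrite /on_main_diag; case: (odd _); case: (odd _).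
Qed.

Definition adjacent x y : Prop :=
  (x.1 - y.1) + (y.1 - x.1) = 1 /\ (x.2 - y.2) + (y.2 - x.2) = 1.

(** This is why monotone tables are nonattacking: if the lower cell [x] is
    occupied, then its position carries a 1; the position of [y] is further
    down and closer to the start of its row, hence carries a 1 as well, and the
    upper cell [y] is empty. *)
Lemma adjacent_coords x y : adjacent x y -> odd x.1 -> ~~ odd y.1 ->
  [/\ on_main_diag x = on_main_diag y, table_col y <= table_col x
    & table_row x <= table_row y].
Proof.
case: x y => [[xr ltxr] [xc ltxc]] [[yr ltyr] [yc ltyc]] [/= dr dc] odd_x even_y.
rewrite /table_col /on_main_diag /table_row /= odd_x (negbTE even_y).
have -> : odd yc = ~~ odd xc by lia.
by case: (boolP (odd xc)) => odd_xc /=; split=> //; lia.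
Qed.

(** Conversely, these adjacencies between blocks force each table to be
    monotone. *)
Lemma adjacent_next_col e i k l : l = k.+1 :> nat ->
  adjacent (cell_at true e i l) (cell_at false e i k).
Proof.
by move=> lE; have := ltn_ord l; case: e; rewrite /adjacent /= lE; lia.
Qed.

Lemma adjacent_next_row e i j k : j = i.+1 :> nat ->
  adjacent (cell_at true e i k) (cell_at false e j k).
Proof.
by move=> jE; case: e; rewrite /adjacent /= jE; lia.
Qed.

(** * Maximum arrangements take one cell of each diagonal *)

Definition partner x : board :=
  cell_at (~~ odd x.1) (on_main_diag x) (table_row x) (table_col x).

Lemma partnerK : involutive partner.
Proof. by move=> x; rewrite /partner !cell_atE negbK cell_at_coords. Qed.

Lemma partner_cell_at b e i k : partner (cell_at b e i k) = cell_at (~~ b) e i k.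
Proof. by rewrite /partner !cell_atE. Qed.

Lemma adjacent_partner x : adjacent x (partner x).
Proof.
rewrite -{1}(cell_at_coords x) /partner.
by case: (odd x.1); case: (on_main_diag x); rewrite /adjacent /=; lia.
Qed.

Definition one_of_each_pair A := forall x, (partner x \in A) = (x \notin A).

Lemma partner_subC A : nonattacking A -> partner @: A \subset ~: A.
Proof.
move=> /nonattackingP nA; apply/subsetP => _ /imsetP[x Ax ->]; rewrite inE.
by apply/negP => Apx; apply: (nA x (partner x) Ax Apx); apply: adjacent_partner.
Qed.

Lemma card_nonattacking A : nonattacking A -> #|A| <= #|~: A|.
Proof.
by move=> /partner_subC/subset_leq_card; rewrite card_imset //; apply: inv_inj partnerK.
Qed.

Lemma one_of_each_pairP A :
  one_of_each_pair A <-> partner @: A = ~: A.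
Proof.
have memP x : (x \in partner @: A) = (partner x \in A).
  apply/imsetP/idP => [[y Ay ->] | Apx]; first by rewrite partnerK.
  by exists (partner x); rewrite ?partnerK.
split=> [pA | eqA x]; first by apply/setP => x; rewrite memP pA inE.
by rewrite -memP eqA inE.
Qed.

Lemma card_one_of_each_pair A : one_of_each_pair A -> #|A| = #|~: A|.
Proof.
move=> /one_of_each_pairP <-; rewrite card_imset //; exact: inv_inj partnerK.
Qed.

(** Row i of table [e] starts with [u e i] ones; a lower cell is occupied when
    the bit of its diagonal is 1, an upper cell when it is 0. *)
Definition arrangement (u : bool -> 'I_m -> nat) : {set board} :=
  [set x | (table_col x < u (on_main_diag x) (table_row x)) == odd x.1].

Definition nondecreasing_rows (u : bool -> 'I_m -> nat) :=
  forall e i j, i <= j -> u e i <= u e j.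

Lemma arrangement_one_of_each_pair u : one_of_each_pair (arrangement u).
Proof. by move=> x; rewrite !inE !cell_atE; case: (_ < _); case: (odd _). Qed.

Lemma nonattacking_arrangement u :
  nondecreasing_rows u -> nonattacking (arrangement u).
Proof.
move=> u_mono.
have lower_upper x y : x \in arrangement u -> y \in arrangement u ->
    odd x.1 -> ~~ odd y.1 -> ~ adjacent x y.
  rewrite !inE => /eqP Ax /eqP Ay odd_x even_y adj_xy.
  have [eq_e le_col le_row] := adjacent_coords adj_xy odd_x even_y.
  move: Ax Ay; rewrite odd_x (negbTE even_y) eq_e => lt_col.
  by rewrite (leq_ltn_trans le_col (leq_trans lt_col (u_mono _ _ _ le_row))).
apply/nonattackingP => x y Ax Ay [dr dc].
have [odd_x | even_x] := boolP (odd x.1).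
  by apply: (lower_upper x y) => //; lia.
by apply: (lower_upper y x) => //; [lia | split; lia].
Qed.

(** The counting bound is attained (here by filling the upper rows of the
    blocks), so a maximum arrangement meets it with equality. *)
Lemma max_nonattackingP A :
  max_nonattacking A <-> nonattacking A /\ one_of_each_pair A.
Proof.
split=> [/andP[nA /forallP maxA] | [nA pA]].
  split=> //; apply/one_of_each_pairP/eqP.
  rewrite eqEcard partner_subC //= card_imset; last exact: inv_inj partnerK.
  pose B := arrangement (fun _ _ => 0).
  have leBA : #|B| <= #|A| by apply: (implyP (maxA B)); apply: nonattacking_arrangement.
  have cardB : #|B| = #|~: B|.
    exact/card_one_of_each_pair/arrangement_one_of_each_pair.
  by rewrite -(leq_add2l #|A|) cardsC -(cardsC B) -cardB leq_add.
rewrite /max_nonattacking nA; apply/forallP => B; apply/implyP => nB.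
rewrite -leq_double -!addnn {2}(card_one_of_each_pair pA) cardsC -(cardsC B).
by rewrite leq_add2l card_nonattacking.
Qed.

(** * Maximum arrangements are pairs of nondecreasing sequences *)

Definition num_lower A e i := #|[pred k | cell_at true e i k \in A]|.

Section Max.

Variable A : {set board}.
Hypotheses (nA : nonattacking A) (pA : one_of_each_pair A).

(** The upper cell adjacent to the occupied lower cell must be empty, so its
    partner is occupied. *)
Lemma lower_forces e i j k l :
  adjacent (cell_at true e i k) (cell_at false e j l) ->
  cell_at true e i k \in A -> cell_at true e j l \in A.
Proof.
move=> adj Ax; rewrite -[true]/(~~ false) -partner_cell_at pA.
by apply/negP => Ay; have /nonattackingP/(_ _ _ Ax Ay) := nA; apply.
Qed.

Lemma mem_lowerE e i k : (cell_at true e i k \in A) = (k < num_lower A e i).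
Proof.
apply: (@initial_segmentE _ [pred k | cell_at true e i k \in A]) => k1 l lE.
exact/lower_forces/adjacent_next_col.
Qed.

Lemma num_lower_next e i j : j = i.+1 :> nat -> num_lower A e i <= num_lower A e j.
Proof.
move=> jE; apply/subset_leq_card/subsetP => k.
exact/lower_forces/adjacent_next_row.
Qed.

Lemma arrangement_num_lower : arrangement (num_lower A) = A.
Proof.
apply/setP => x; rewrite inE -mem_lowerE.
have [odd_x | even_x] := boolP (odd x.1).
  by have := cell_at_coords x; rewrite odd_x => ->; rewrite eqb_id.
have /= := pA x; rewrite /partner (negbTE even_x) => ->.
by rewrite eqbF_neg negbK.
Qed.

End Max.

Definition sorted_tuples : {set m.-tuple 'I_m.+1} :=
  [set t : m.-tuple 'I_m.+1 | sorted leq (map val t)].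

Definition tables (f : {ffun bool -> m.-tuple 'I_m.+1}) e i : nat :=
  tnth (f e) i.

Lemma nondecreasing_tables f :
  f \in ffun_on sorted_tuples -> nondecreasing_rows (tables f).
Proof.
move=> /ffun_onP f_sorted e i j le_ij; have := f_sorted e; rewrite inE => fe.
have szE : size (map val (f e)) = m by rewrite size_map size_tuple.
have := sorted_leq_nth leq_trans leqnn 0 fe.
move=> /(_ i j); rewrite !inE !szE !ltn_ord => /(_ isT isT le_ij).
by rewrite !(nth_map ord0) ?size_tuple ?ltn_ord // /tables !(tnth_nth ord0).
Qed.

(** The lower cells of row i of table [e] show the bits of that row, hence
    their number of 1s. *)
Lemma arrangement_tables_inj : injective (fun f => arrangement (tables f)).
Proof.
move=> f g eq_fg; apply/ffunP => e; apply: eq_from_tnth => i; apply: val_inj.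
have le_m (h : {ffun bool -> m.-tuple 'I_m.+1}) : tables h e i <= m.
  by rewrite -ltnS ltn_ord.
apply: (eq_threshold (le_m f) (le_m g)) => k.
by have /setP/(_ (cell_at true e i k)) := eq_fg; rewrite !inE !cell_atE !eqb_id.
Qed.

Lemma max_nonattacking_imset :
  [set A : {set board} | max_nonattacking A] =
  [set arrangement (tables f) | f in ffun_on sorted_tuples].
Proof.
apply/setP => A; rewrite inE; apply/idP/imsetP => [/max_nonattackingP[nA pA] |].
  have lt_m e i : num_lower A e i < m.+1.
    by rewrite ltnS (leq_trans (max_card _)) ?card_ord.
  pose f := [ffun e => [tuple Ordinal (lt_m e i) | i < m]].
  have fE e i : tables f e i = num_lower A e i by rewrite /tables ffunE tnth_mktuple.
  exists f.
    apply/ffun_onP => e; rewrite inE; apply/(sortedP 0) => i.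
    rewrite size_map size_tuple => lti1.
    have lti := ltnW lti1.
    have := @num_lower_next _ nA pA e (Ordinal lti) (Ordinal lti1) erefl.
    by rewrite -!fE /tables !(tnth_nth ord0) !(nth_map ord0) ?size_tuple.
  rewrite -[LHS](arrangement_num_lower nA pA).
  by apply/setP => x; rewrite !inE fE.
case=> f f_sorted ->; apply/max_nonattackingP; split.
  exact/nonattacking_arrangement/nondecreasing_tables.
exact: arrangement_one_of_each_pair.
Qed.

End Board.

(** A nondecreasing m-tuple with values in 0..m is a multiset of size m of m + 1
    values, which gives C(2m, m) for each of the two tables. *)
Theorem theorem2p9 (m : nat) (hm : 1 <= m) :
  #|[set A : {set cell (2 * m) (2 * m)} | max_nonattacking A]| = 'C(2 * m, m) ^ 2.
Proof.
rewrite max_nonattacking_imset card_imset; last exact: arrangement_tables_inj.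
by rewrite card_ffun_on card_bool card_sorted_tuples mul2n -addnn.
Qed.
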